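(* Let $\mathcal{X}=(\mathcal{V},\varrho,\upsilon)$ be a fuzzy graph. Then for every vertex $u\in\mathcal{V}$, $$\gamma_s(\mathcal{X})\le {}_{sd}d(u)\le \Gamma_s(\mathcal{X}).$$
   Context: A fuzzy graph $\mathcal{X}=(\mathcal{V},\varrho,\upsilon)$ consists of a nonempty finite set $\mathcal{V}$ of vertices, a function $\varrho:\mathcal{V}\to[0,1]$ and a symmetric function $\upsilon:\mathcal{V}\times\mathcal{V}\to[0,1]$ with $\upsilon(ab)\le\min(\varrho(a),\varrho(b))$ for all $a,b$, and no loops ($\upsilon(aa)=0$). Put $\varrho^*=\{a:\varrho(a)>0\}$ and $\upsilon^*=\{ab:\upsilon(ab)>0\}$; it is assumed that $\mathcal{V}=\varrho^*$, and the elements of $\upsilon^*$ are called edges. A path is a sequence of distinct vertices $a_1,\dots,a_n$ with $\upsilon(a_ia_{i+1})>0$ for all $i<n$; its strength is the minimum of the weights $\upsilon$ of its edges. The strength of connectedness between $a$ and $b$ is the maximum of the strengths of all paths from $a$ to $b$ (and $0$ if there is none). An edge $ab$ is strong if $\upsilon(ab)$ is at least the strength of connectedness between $a$ and $b$ in the fuzzy graph obtained by deleting the edge $ab$. A set $\mathcal{D}\subseteq\mathcal{V}$ is a strong dominating set (SDS) if every $b\in\mathcal{V}\setminus\mathcal{D}$ is joined by a strong edge to some $a\in\mathcal{D}$. An SDS $\mathcal{D}$ is a minimal strong dominating set (MSDS) if $\mathcal{D}\setminus\{a\}$ is not an SDS for every $a\in\mathcal{D}$. The weight of $\mathcal{S}\subseteq\mathcal{V}$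 is $W(\mathcal{S})=\sum_{a\in\mathcal{S}}\min\{\upsilon(ab): ab \text{ is a strong edge}\}$; whenever weights are used it is understood that every vertex is incident with at least one strong edge. The strong domination number $\gamma_s(\mathcal{X})$ is the minimum weight of an SDS; the upper strong domination number $\Gamma_s(\mathcal{X})$ is the maximum weight of an MSDS; the strong domination degree ${}_{sd}d(u)$ of a vertex $u$ is the minimum of the weights of the MSDSs containing $u$. *)

(* Defs.v *)
From HB Require Import structures.
From mathcomp Require Import all_boot all_order all_algebra.

Set Implicit Arguments.
Unset Strict Implicit.
Unset Printing Implicit Defensive.

Import Order.TTheory GRing.Theory Num.Theory.

Local Open Scope ring_scope.

(* Minimum and maximum of a real-valued function over the elements of a finite
   type that satisfy P; the value is 0 when there is no such element. *)
Definition min_over (R : realFieldType) (T : finType) (P : pred T)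
    (F : T -> R) : R :=
  if [pick x | P x] is Some x0 then F [arg min_(x < x0 | P x) F x]%O else 0.

Definition max_over (R : realFieldType) (T : finType) (P : pred T)
    (F : T -> R) : R :=
  if [pick x | P x] is Some x0 then F [arg max_(x > x0 | P x) F x]%O else 0.

Record fuzzy_graph (R : realFieldType) (V : finType) := FuzzyGraph {
  rho : V -> R;
  ups : V -> V -> R;
  vertex_nonempty : (0 < #|V|)%N;
  rho_gt0 : forall a, 0 < rho a;
  rho_le1 : forall a, rho a <= 1;
  ups_ge0 : forall a b, 0 <= ups a b;
  ups_le1 : forall a b, ups a b <= 1;
  ups_sym : forall a b, ups a b = ups b a;
  ups_le_min : forall a b, ups a b <= Num.min (rho a) (rho b);
  ups_loopless : forall a, ups a a = 0
}.

Section FuzzyGraph.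
Variables (R : realFieldType) (V : finType).
Implicit Types (X : fuzzy_graph R V) (a b u : V) (D : {set V}).

Definition is_edge X : rel V := fun a b => 0 < ups X a b.

Definition same_edge (a b c d : V) : bool :=
  ((c == a) && (d == b)) || ((c == b) && (d == a)).

Definition del_ups X a b (c d : V) : R :=
  if same_edge a b c d then 0 else ups X c d.

Fact del_ups_ge0 X a b c d : 0 <= del_ups X a b c d.
Proof. by rewrite /del_ups; case: ifP => // _; apply: ups_ge0. Qed.

Fact del_ups_le1 X a b c d : del_ups X a b c d <= 1.
Proof. by rewrite /del_ups; case: ifP => _; rewrite ?ler01 ?ups_le1. Qed.

Fact del_ups_sym X a b c d : del_ups X a b c d = del_ups X a b d c.
Proof.
rewrite /del_ups /same_edge (ups_sym X c d) orbC.
by rewrite [(c == b) && _]andbC [(c == a) && _]andbC.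
Qed.

Fact del_ups_le_min X a b c d :
  del_ups X a b c d <= Num.min (rho X c) (rho X d).
Proof.
rewrite /del_ups; case: ifP => _; last exact: ups_le_min.
by rewrite le_min !ltW ?rho_gt0.
Qed.

Fact del_ups_loopless X a b c : del_ups X a b c c = 0.
Proof. by rewrite /del_ups ups_loopless if_same. Qed.

Definition delete_edge X a b : fuzzy_graph R V :=
  FuzzyGraph (vertex_nonempty X) (rho_gt0 X) (rho_le1 X)
    (del_ups_ge0 X a b) (del_ups_le1 X a b) (del_ups_sym X a b)
    (del_ups_le_min X a b) (del_ups_loopless X a b).

(* A path from a to b is given by a and the sequence p of its later vertices. *)
Definition is_path X a b (p : seq V) : bool :=
  [&& path (is_edge X) a p, last a p == b & uniq (a :: p)].

(* [pairmap] lists the weights of the consecutive edges of a :: p; they are all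
   at most 1, so the default 1 only matters for the edgeless path p = [::]. *)
Definition strength X a (p : seq V) : R :=
  \big[Num.min/1]_(w <- pairmap (ups X) a p) w.

(* The vertices of a path are distinct, so sequences of length at most #|V|
   include all paths. *)
Definition connectedness X a b : R :=
  \big[Num.max/0]_(p : #|V|.-bseq V | is_path X a b p) strength X a p.

Definition strong_edge X : rel V := fun a b =>
  is_edge X a b && (connectedness (delete_edge X a b) a b <= ups X a b).

Definition is_SDS X D : bool :=
  [forall b in ~: D, [exists a in D, strong_edge X a b]].

Definition is_MSDS X D : bool :=
  is_SDS X D && [forall a in D, ~~ is_SDS X (D :\ a)].

Definition no_strongly_isolated X : Prop :=
  forall a, exists b, strong_edge X a b.

Definition weight X D : R :=
  \sum_(a in D) min_over (strong_edge X a) (ups X a).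

Definition strong_domination_number X : R :=
  min_over (is_SDS X) (weight X).

Definition upper_strong_domination_number X : R :=
  max_over (is_MSDS X) (weight X).

(* When no vertex is strongly isolated every SDS has positive weight, so the
   value 0 of an empty minimum or maximum is never the weight of an SDS. *)
Definition strong_domination_degree X u : R :=
  min_over (fun D => is_MSDS X D && (u \in D)) (weight X).

End FuzzyGraph.

(* Main.v *)
(* The strong-edge relation is symmetric, because reversing a path preserves
   its strength.  Hence a maximal set of pairwise non-strongly-adjacent vertices
   containing u is strongly dominating by maximality and minimal by
   independence, so MSDSs containing u exist.  The degree of u is therefore the
   weight of an actual MSDS, which is an SDS. *)
Require Import Defs.
From HB Require Import structures.
From mathcomp Require Import all_boot all_order all_algebra.

Set Implicit Arguments.
Unset Strict Implicit.
Unset Printing Implicit Defensive.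

Import Order.TTheory GRing.Theory Num.Theory.

Local Open Scope ring_scope.

(** The witness [x] excludes the default value 0 of an empty minimum. *)
Lemma min_over_attained (R : realFieldType) (T : finType) (P : pred T)
    (F : T -> R) (x : T) :
  P x -> exists2 y, P y & min_over P F = F y.
Proof.
rewrite /min_over; case: pickP => [x0 Px0 _ | ->//].
by case: arg_minP => // y Py _; exists y.
Qed.

Lemma min_over_le (R : realFieldType) (T : finType) (P : pred T)
    (F : T -> R) (x : T) :
  P x -> min_over P F <= F x.
Proof.
rewrite /min_over; case: pickP => [x0 Px0 Px | ->//].
by case: arg_minP => // y _; apply.
Qed.

Lemma max_over_ge (R : realFieldType) (T : finType) (P : pred T)
    (F : T -> R) (x : T) :
  P x -> F x <= max_over P F.
Proof.
rewrite /max_over; case: pickP => [x0 Px0 Px | ->//].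
by case: arg_maxP => // y _; apply.
Qed.

(** Paths are stored as a first vertex and a tail: reversing [x :: s] gives first vertex [last x s]
    and tail [rev (belast x s)]. *)
Lemma last_rev_belast (T : Type) (x : T) (s : seq T) :
  last (last x s) (rev (belast x s)) = x.
Proof. by case: s => //= y s; rewrite rev_cons last_rcons. Qed.

Lemma pairmap_rev (T S : Type) (f : T -> T -> S) (x : T) (s : seq T) :
  (forall y z, f y z = f z y) ->
  pairmap f (last x s) (rev (belast x s)) = rev (pairmap f x s).
Proof.
move=> f_sym; elim: s x => //= y s IHs x.
by rewrite !rev_cons -!cats1 pairmap_cat IHs last_rev_belast /= f_sym.
Qed.

Section Existence.
Variables (R : realFieldType) (V : finType).
Implicit Types (X Y : fuzzy_graph R V) (a b u : V) (D : {set V}).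

(** Two graphs are needed because deleting [a b] and deleting [b a] give records whose weights agree
    only pointwise. *)
Lemma eq_strength_rev X Y a p : ups X =2 ups Y ->
  strength Y (last a p) (rev (belast a p)) = strength X a p.
Proof.
move=> eqXY; rewrite /strength (pairmap_rev _ _ (ups_sym Y)).
have ->: pairmap (ups Y) a p = pairmap (ups X) a p.
  by elim: p a => //= b p IHp a; rewrite IHp eqXY.
(* A minimum depends only on which entries occur, so inclusion both ways gives equality. *)
by apply/le_anti/andP; split; apply: sub_bigmin_seq => w; rewrite mem_rev.
Qed.

Lemma is_path_rev X Y a b p : ups X =2 ups Y ->
  is_path X a b p -> is_path Y b a (rev (belast a p)).
Proof.
move=> eqXY /and3P[Xp /eqP <- Up]; apply/and3P; split.
- rewrite rev_path; apply: sub_path Xp => c d.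
  by rewrite /is_edge /= -eqXY (ups_sym X).
- by rewrite last_rev_belast.
- by rewrite -rev_rcons rev_uniq -lastI.
Qed.

Lemma connectedness_rev_le X Y a b : ups X =2 ups Y ->
  connectedness X a b <= connectedness Y b a.
Proof.
move=> eqXY; apply/bigmax_leP; split; first exact: bigmax_ge_id.
(* Reversal keeps the length, so the reversed path is again among the bounded sequences over which
   the maximum is taken. *)
move=> p Xp; have szq : (size (rev (belast a p)) <= #|V|)%N.
  by rewrite size_rev size_belast size_bseq.
rewrite -(eq_strength_rev a p eqXY); have /and3P[_ /eqP-> _] := Xp.
apply: (le_bigmax_cond _ (j := Bseq szq) (P := fun q => is_path Y b a q)
  (strength Y b)).
exact: is_path_rev eqXY Xp.
Qed.

Lemma delete_edgeC X a b : ups (delete_edge X a b) =2 ups (delete_edge X b a).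
Proof. by move=> c d; rewrite /= /del_ups /same_edge orbC. Qed.

Lemma strong_edge_sym X : symmetric (strong_edge X).
Proof.
suff imp a b : strong_edge X a b -> strong_edge X b a.
  by move=> a b; apply/idP/idP; apply: imp.
rewrite /strong_edge /is_edge (ups_sym X a b) => /andP[-> /=].
by apply: le_trans; apply: connectedness_rev_le; apply: delete_edgeC.
Qed.

Lemma strong_edge_irr X a : strong_edge X a a = false.
Proof. by rewrite /strong_edge /is_edge ups_loopless ltxx. Qed.

Definition strong_independent X D :=
  [forall a in D, forall b in D, ~~ strong_edge X a b].

Lemma strong_independentP X D :
  reflect {in D &, forall a b, ~~ strong_edge X a b} (strong_independent X D).
Proof.
apply: (iffP forall_inP) => [indD a b Da | indD a Da].
  by move: b; apply/forall_inP/indD.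
by apply/forall_inP => b; apply: indD.
Qed.

Lemma maxset_strong_independent_MSDS X D :
  maxset (strong_independent X) D -> is_MSDS X D.
Proof.
case/maxsetP => /strong_independentP indD maxD; apply/andP; split.
  apply/forall_inP => b; rewrite inE => nDb; apply: contraNT nDb => ndomb.
  have {}ndomb a : a \in D -> ~~ strong_edge X a b.
    by move=> Da; apply: contra ndomb => Xab; apply/exists_inP; exists a.
  (* An undominated [b] could be added to [D] without losing independence, so by maximality it
     already lies in [D]. *)
  rewrite -(maxD (b |: D)) ?setU11 ?subsetUr //.
  apply/strong_independentP => c d; rewrite !in_setU1.
  case/predU1P => [-> | Dc] /predU1P[-> | Dd]; rewrite ?strong_edge_irr //.
  - by rewrite strong_edge_sym ndomb.
  - exact: ndomb.
  - exact: indD.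
(* Once removed, [a] would have to be dominated by some [c] in [D], against independence. *)
apply/forall_inP => a Da; apply/negP => /forall_inP/(_ a).
rewrite !inE eqxx => /(_ isT)/exists_inP[c]; rewrite !inE => /andP[_ Dc].
exact/negP/indD.
Qed.

(** Without loops [[set u]] is independent, hence extends to a maximal independent set. *)
Lemma MSDS_containing X u : exists D, is_MSDS X D && (u \in D).
Proof.
have ind1 : strong_independent X [set u].
  by apply/strong_independentP => a b /set1P-> /set1P->; rewrite strong_edge_irr.
have [D maxD] := maxset_exists ind1; rewrite sub1set => Du.
by exists D; rewrite maxset_strong_independent_MSDS.
Qed.

End Existence.

Theorem theorem3p12 (R : realFieldType) (V : finType) (X : fuzzy_graph R V)
    (hX : no_strongly_isolated X) (u : V) :
  strong_domination_number X <= strong_domination_degree X u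
    <= upper_strong_domination_number X.
Proof.
rewrite /strong_domination_degree; have [D0 D0u] := MSDS_containing X u.
have [D /andP[msD _] ->] := min_over_attained
  (P := fun D => is_MSDS X D && (u \in D)) (weight X) D0u.
by rewrite max_over_ge // min_over_le //; have /andP[] := msD.
Qed.
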